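(* Let $(U,V)$ be a pair of real random variables and let $F$ be the distribution function of $U$. Assume: (1) $\sup\{x:F(x)<1\}=\infty$, and $F\in MDA(\Lambda)$ with auxiliary function $f$; (2) $\lim_{x\to\infty}\dfrac{P(V>x)}{P(U>x)}=c\in(0,\infty)$; (3) for all $t>0$, $\lim_{x\to\infty}P(|V|>tf(x)\mid U>x)=0$; (4) for all $t>0$, $\lim_{x\to\infty}P(|U|>tf(x)\mid V>x)=0$; (5) for some $L>0$, $\lim_{x\to\infty}\dfrac{P(V>Lf(x),\,U>Lf(x))}{P(U>x)}=0$. Let $a_1,a_2\ge0$, not both zero, and define $\hat S_2=a_1U+a_2V$ and $m_2=\max(a_1,a_2)$. Then, as $x\to\infty$, $$P(\hat S_2>x)\sim P\Bigl(U>\frac{x}{m_2}\Bigr)\Bigl[1_{\{a_1=m_2\}}+c\,1_{\{a_2=m_2\}}\Bigr].$$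
   Context: $MDA(\Lambda)$ is the maximal domain of attraction of the Gumbel distribution $\Lambda(x)=\exp\{-e^{-x}\}$: the class of distribution functions $F$ for which there exist $\alpha_n>0$, $\beta_n\in\mathbb{R}$ with $\lim_{n\to\infty}n\bar F(\alpha_nx+\beta_n)=e^{-x}$ for all $x\in\mathbb{R}$, where $\bar F=1-F$. When $F$ has infinite right endpoint, $F\in MDA(\Lambda)$ is equivalent to the existence of an auxiliary function $f$: a positive function with derivative converging to $0$ at infinity, self-neglecting (i.e. $\lim_{t\to\infty}f(t+xf(t))/f(t)=1$ for all $x\in\mathbb{R}$), such that $\lim_{t\to\infty}\bar F(t+xf(t))/\bar F(t)=e^{-x}$ for all $x\in\mathbb{R}$. The function $f$ in the claim is such an auxiliary function of $F$. The notation $g(x)\sim h(x)$ means $g(x)/h(x)\to1$; $1_{\{\cdot\}}$ is the indicator. *)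

(* Defs.v *)
From HB Require Import structures.
From mathcomp Require Export all_boot all_order all_algebra.
From mathcomp Require Export all_classical all_reals all_analysis.

Set Implicit Arguments.
Unset Strict Implicit.
Unset Printing Implicit Defensive.

Export Order.TTheory GRing.Theory Num.Theory.
Export numFieldNormedType.Exports.

Local Open Scope classical_set_scope.
Local Open Scope ring_scope.

Section extreme_value.
Context {R : realType}.
Implicit Types (F f g h : R -> R).

Definition survival F : R -> R := fun x => 1 - F x.

Definition right_endpoint F : \bar R :=
  ereal_sup [set x%:E | x in [set x : R | F x < 1]].

Definition MDA_Gumbel F : Prop :=
  exists alpha beta : R^nat,
    (forall n, 0 < alpha n) /\
    (forall x : R,
       n%:R * survival F (alpha n * x + beta n) @[n --> \oo] --> expR (- x)).

Definition self_neglecting f : Prop :=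
  forall x : R, f (t + x * f t) / f t @[t --> +oo] --> (1 : R).

(* Positivity and differentiability are only required near +oo: auxiliary
   functions are commonly defined on a half-line only (e.g. t |-> 1 / t for the
   normal law), and every condition below depends only on their germ at +oo. *)
Definition auxiliary_function F f : Prop :=
  [/\ \forall x \near +oo, 0 < f x,
      \forall x \near +oo, derivable f x 1,
      derive1 f x @[x --> +oo] --> (0 : R),
      self_neglecting f &
      forall x : R,
        survival F (t + x * f t) / survival F t @[t --> +oo] --> expR (- x)].

Definition asymp_equiv g h : Prop := g x / h x @[x --> +oo] --> (1 : R).

End extreme_value.

Section probability.
Context {d : measure_display} {T : measurableType d} {R : realType}.
Variable P : probability T R.

Definition Pr (A : set T) : R := fine (P A).

Definition condPr (A B : set T) : R := Pr (A `&` B) / Pr B.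

Definition distribution_function (X : {RV P >-> R}) : R -> R :=
  fun x => fine (cdf X x).

End probability.

(* Main.v *)
(* Dividing by [m2], consider [aU + bV] with [a, b <= 1]. Write [G] for the tail
   of [U] and let [k > 0] be small. Up to events of probability
   [o(G y)], [aU + bV > y] forces [aU > y - k f(y)] or [bV > y - k f(y)]:
   otherwise both [U] and [V] exceed [k f(y)], and either one of them exceeds
   [y - L f(y)] while the other exceeds [k f(y)], which is negligible by the
   conditional hypotheses, or both exceed [L f(y)]. Conversely
   [aU > y + k f(y)] with [|V| <= k f(y)] forces [aU + bV > y], and the two
   events of this kind are almost disjoint. Finally
   [P(aU > y + h f(y)) / G y] tends to [exp (- h)] if [a = 1] and to 0 if
   [a < 1], since [y - K f(y)] tends to +oo for every [K]; let [k] tend to 0. *)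
Require Import Defs.
From mathcomp Require Import lra measurable_realfun.

Set Implicit Arguments.
Unset Strict Implicit.
Unset Printing Implicit Defensive.

Local Open Scope classical_set_scope.
Local Open Scope ring_scope.

(** * Shifts of a Gumbel tail by multiples of its auxiliary function *)

Section gumbel_tails.
Context {R : realType}.
Implicit Types (f l u p G H : R -> R).

(** Positivity of [a * x] excludes negative [x], where the inequality can fail. *)
Lemma scaled_le (a x : R) : 0 <= a <= 1 -> 0 < a * x -> a * x <= x.
Proof.
move=> /andP[a0 a1] ax.
have x0 : 0 < x by rewrite ltNge; apply/negP => /(ler_wpM2l a0); lra.
by rewrite ler_piMl// ltW.
Qed.

Lemma scaled_norm_ge (a : R) : 0 <= a <= 1 -> forall x, - `|x| <= a * x.
Proof.
move=> /andP[a0 a1] x; rewrite lerNl (le_trans (ler_norm _))// normrN normrM.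
by rewrite ger0_norm// ler_piMl.
Qed.

(** This is the passage to the limit in [k]. The bounds may depend on [k]: given [e], one small [k]
    puts both limits within [e] of [C], and only then does [x] grow. *)
Lemma cvg_between_expR p (C : R) :
  (forall k, 0 < k -> exists l u,
    [/\ \forall x \near +oo, l x <= p x <= u x,
        l x @[x --> +oo] --> C * expR (- k) &
        u x @[x --> +oo] --> C * expR k]) ->
  p x @[x --> +oo] --> C.
Proof.
move=> pb; apply/cvgrPdist_lt => e e0.
have cE (s : R) : C * expR (s * k) @[k --> (0 : R)^'+] --> C.
  rewrite -[X in _ --> X]mulr1; apply: cvgMl_tmp; apply: cvg_at_right_filter.
  rewrite -(@expR0 R) -[X in expR X](mulr0 s).
  apply: (@continuous_comp _ _ _ ( *%R s) expR); last exact: continuous_expR.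
  exact: mulrl_continuous.
have [k [k0 Cl Cu]] : exists k, [/\ 0 < k, C - e < C * expR (- k) &
    C * expR k < C + e].
  have := cvgr_gt _ (cE (-1)) (C - e); have := cvgr_lt _ (cE 1) (C + e).
  rewrite ltrDl gtrBl => /(_ _ e0) Cu /(_ _ e0) Cl.
  near (0 : R)^'+ => k; exists k; rewrite -[- k]mulN1r -[X in _ * expR X < _]mul1r.
  by split; near: k => //; exact: nbhs_right_gt.
have [l [u [pl lC uC]]] := pb k k0.
near=> x; have /andP[lp pu] : l x <= p x <= u x by near: x.
have : C - e < l x by near: x; exact: cvgr_gt lC _ Cl.
have : u x < C + e by near: x; exact: cvgr_lt uC _ Cu.
by rewrite ltr_norml; lra.
Unshelve. all: by end_near. Qed.

(** The reference tail, detached from any random variable, so that the tails of [U] and [V] can both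
    be measured against it. *)
Definition gumbel_tail G f := [/\ (forall x, 0 < G x),
  {homo G : x y /~ x <= y}, G x @[x --> +oo] --> 0,
  \forall x \near +oo, 0 < f x &
  forall x, G (t + x * f t) / G t @[t --> +oo] --> expR (- x)].

(* [G (t + k f t)] is asymptotic to [exp (- k) G t], hence tends to 0, and a
   positive nonincreasing [G] tends to 0 only along arguments tending to +oo. *)
Lemma gumbel_tail_shift_cvgy G f (k : R) : gumbel_tail G f ->
  t + k * f t @[t --> +oo] --> +oo.
Proof.
move=> [G0 Gni Gcv _ Gf]; apply/cvgryPgt => M.
have Gk : G (t + k * f t) @[t --> +oo] --> 0.
  rewrite -(mulr0 (expR (- k))).
  apply: cvg_trans (cvgM (Gf k) Gcv); apply: near_eq_cvg.
  by near=> t; rewrite /= divfK ?gt_eqF.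
near=> t; rewrite ltNge; apply/negP => /Gni.
apply/negP; rewrite -ltNge; near: t; exact: cvgr_lt Gk _ (G0 M).
Unshelve. all: by end_near. Qed.

(** With z = t + k f(t), which tends to +oo, factor H(z) / G(t) as H(z) / G(z) times G(z) / G(t). *)
Lemma gumbel_tail_equiv_shift G f H (c k : R) : gumbel_tail G f ->
  H x / G x @[x --> +oo] --> c ->
  H (t + k * f t) / G t @[t --> +oo] --> c * expR (- k).
Proof.
move=> GT Hc; have [G0 _ _ _ Gf] := GT.
have Hk : H (t + k * f t) / G (t + k * f t) @[t --> +oo] --> c.
  apply: (cvg_comp (fun t => t + k * f t) (fun x => H x / G x) _ Hc).
  exact: gumbel_tail_shift_cvgy GT.
apply: cvg_trans (cvgM Hk (Gf k)); apply: near_eq_cvg; near=> t => /=.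
by rewrite mulrA divfK ?gt_eqF.
Unshelve. all: by end_near. Qed.

End gumbel_tails.

(** * Single, joint and combined tail probabilities *)

Section tail_probabilities.
Context d (T : measurableType d) (R : realType) (P : probability T R).
Implicit Types (A B : set T).

Lemma le_Pr A B : measurable A -> measurable B -> A `<=` B -> Pr P A <= Pr P B.
Proof.
by move=> mA mB AB; rewrite fine_le ?fin_num_measure// le_measure ?inE.
Qed.

Lemma Pr_ge0 A : 0 <= Pr P A. Proof. exact: fine_ge0. Qed.

Lemma PrU_le A B : measurable A -> measurable B ->
  Pr P (A `|` B) <= Pr P A + Pr P B.
Proof.
move=> mA mB; rewrite -fineD ?fin_num_measure// fine_le ?measureU2//.
- by rewrite fin_num_measure//; exact: measurableU.
- by rewrite fin_numD !fin_num_measure.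
Qed.

Lemma PrUI A B : measurable A -> measurable B ->
  Pr P A + Pr P B = Pr P (A `|` B) + Pr P (A `&` B).
Proof.
move=> mA mB; have mI := measurableI _ _ mA mB.
rewrite /Pr measureUfinr//; last by rewrite ltey_eq fin_num_measure.
by rewrite fineB ?fineD ?fin_numD ?fin_num_measure// subrK.
Qed.

Lemma measurable_gt (X : T -> R) (x : R) :
  measurable_fun setT X -> measurable [set w | x < X w].
Proof.
move=> mX; have := mX measurableT _ (measurable_itv `]x, +oo[).
by rewrite setTI preimage_itvoy.
Qed.

(** If [a < 1], then for every [K] the event eventually lies in [X > y + K f(y)], whose ratio to
    [G y] tends to [c * expR (- K)]; this is small for large [K]. *)
Lemma Pr_scaled_tail (X : {RV P >-> R}) (G f : R -> R) (c a k : R) :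
  gumbel_tail G f ->
  Pr P [set w | x < X w] / G x @[x --> +oo] --> c ->
  0 <= a <= 1 ->
  Pr P [set w | y + k * f y < a * X w] / G y @[y --> +oo] -->
    (a == 1)%:R * c * expR (- k).
Proof.
move=> GT Xc /andP[a0 a1]; have Xs K := gumbel_tail_equiv_shift (k := K) GT Xc.
have [->|an1] := eqVneq a 1.
  by rewrite mul1r; under eq_fun do under eq_set do rewrite mul1r; exact: Xs.
have {an1}a1 : a < 1 by rewrite lt_neqAle an1.
rewrite !mul0r; apply/cvgr0Pnorm_lt => e e0.
have [K cK] : exists K, c * expR (- K) < e.
  have : c * expR (- K) @[K --> +oo] --> c * 0.
    by apply: cvgMl_tmp; exact: cvgr_expR.
  rewrite mulr0 => /cvgr_lt/(_ _ e0) cK.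
  by near (pinfty_nbhs R) => K; exists K; near: K.
have [G0 _ _ _ _] := GT.
(* The constant is chosen so that a (y + K f(y)) < y + k f(y) amounts to positivity of this shift of
   y. *)
have := gumbel_tail_shift_cvgy ((k - a * K) / (1 - a)) GT.
move=> /cvgry_gt/(_ 0) shift0.
near=> y; rewrite ger0_norm ?divr_ge0 ?Pr_ge0 ?ltW//.
apply: (@le_lt_trans _ _ (Pr P [set w | y + K * f y < X w] / G y)); last first.
  by near: y; exact: cvgr_lt (Xs K) _ cK.
rewrite ler_pM2r ?invr_gt0//; apply: le_Pr.
- by apply: measurable_gt; exact: measurable_funM.
- exact: measurable_gt.
- move=> w /= aX.
  have : 0 < y + (k - a * K) / (1 - a) * f y by near: y.
  rewrite -(@pmulr_rgt0 _ (1 - a)) ?subr_gt0// mulrDr mulrA.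
  rewrite [(1 - a) * (_ / _)]mulrC divfK ?gt_eqF ?subr_gt0// => ay.
  rewrite ltNge; apply/negP => /(ler_wpM2l a0); lra.
Unshelve. all: by end_near. Qed.

(** The conditional hypothesis is applied at z = y + k f(y), where its threshold is a multiple of
    f(z). Self-neglect gives f(z) < 2 f(y) eventually, so the threshold (t/2) f(z) stays below t
    f(y). *)
Lemma Pr_joint_tail (X Y : {RV P >-> R}) (G f : R -> R) (c k t : R) :
  gumbel_tail G f -> self_neglecting f ->
  Pr P [set w | x < X w] / G x @[x --> +oo] --> c ->
  (forall s, 0 < s ->
    condPr P [set w | s * f x < `|Y w|] [set w | x < X w]
      @[x --> +oo] --> (0 : R)) ->
  0 < t ->
  Pr P ([set w | y + k * f y < X w] `&` [set w | t * f y < `|Y w|]) / G y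
    @[y --> +oo] --> (0 : R).
Proof.
move=> GT fSN Xc XY t0; have [G0 _ _ f0 _] := GT.
pose z y := y + k * f y; have zy : z y @[y --> +oo] --> +oo.
  exact: gumbel_tail_shift_cvgy GT.
pose q x := condPr P [set w | t / 2 * f x < `|Y w|] [set w | x < X w].
have qz : q (z y) @[y --> +oo] --> 0.
  by apply: (cvg_comp z q zy); apply: XY; lra.
have Xz := gumbel_tail_equiv_shift (k := k) GT Xc.
have up : q (z y) * (Pr P [set w | z y < X w] / G y) @[y --> +oo] --> 0.
  by rewrite -(mul0r (c * expR (- k))); exact: cvgM.
apply: (squeeze_cvgr _ (cvg_cst 0) up).
have f2 : \forall y \near +oo, f (z y) / f y < 2.
  by apply: cvgr_lt (fSN k) _ _; lra.
near=> y.
have fy0 : 0 < f y by near: y.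
have fzy : f (z y) < 2 * f y by rewrite -ltr_pdivrMr//; near: y.
have mX : measurable [set w | z y < X w] by exact: measurable_gt.
have mY s : measurable [set w | s < `|Y w|].
  by apply: measurable_gt; exact: measurableT_comp.
rewrite divr_ge0 ?Pr_ge0 ?(ltW (G0 y))//= mulrA ler_pM2r ?invr_gt0// /q /condPr.
(* [condPr] divides by this probability; if it vanishes, so does the joint probability. *)
have [X0|X0] := eqVneq (Pr P [set w | z y < X w]) 0.
  rewrite X0 mulr0 -[leRHS]X0; by apply: le_Pr => //; exact: measurableI.
rewrite divfK//; apply: le_Pr; [exact: measurableI..|].
move=> w /= [Xw Yw]; split=> //; apply: le_lt_trans Yw; nra.
Unshelve. all: by end_near. Qed.

Lemma Pr_lincomb_tail (U V : {RV P >-> R}) (G f : R -> R) (cU cV L a b : R) :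
  gumbel_tail G f -> self_neglecting f ->
  Pr P [set w | x < U w] / G x @[x --> +oo] --> cU ->
  Pr P [set w | x < V w] / G x @[x --> +oo] --> cV ->
  (forall t, 0 < t ->
    condPr P [set w | t * f x < `|V w|] [set w | x < U w]
      @[x --> +oo] --> (0 : R)) ->
  (forall t, 0 < t ->
    condPr P [set w | t * f x < `|U w|] [set w | x < V w]
      @[x --> +oo] --> (0 : R)) ->
  Pr P [set w | L * f x < V w /\ L * f x < U w] / G x
    @[x --> +oo] --> (0 : R) ->
  0 <= a <= 1 -> 0 <= b <= 1 ->
  Pr P [set w | y < a * U w + b * V w] / G y @[y --> +oo] -->
    (a == 1)%:R * cU + (b == 1)%:R * cV.
Proof.
move=> GT fSN Uc Vc UV VU joint ab01 bb01; apply: cvg_between_expR => k k0.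
have [G0 _ _ f0 _] := GT.
pose A h y := [set w | y + h * f y < a * U w].
pose B h y := [set w | y + h * f y < b * V w].
pose A' h y := [set w | y + h * f y < U w] `&` [set w | k * f y < `|V w|].
pose B' h y := [set w | y + h * f y < V w] `&` [set w | k * f y < `|U w|].
pose J y := [set w | L * f y < V w /\ L * f y < U w].
have cA h : Pr P (A h y) / G y @[y --> +oo] --> (a == 1)%:R * cU * expR (- h).
  exact: Pr_scaled_tail.
have cB h : Pr P (B h y) / G y @[y --> +oo] --> (b == 1)%:R * cV * expR (- h).
  exact: Pr_scaled_tail.
have cA' h : Pr P (A' h y) / G y @[y --> +oo] --> 0.
  exact: Pr_joint_tail fSN Uc UV _.
have cB' h : Pr P (B' h y) / G y @[y --> +oo] --> 0.
  exact: Pr_joint_tail fSN Vc VU _.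
(* [A'] is subtracted twice: once for the part of [A] where [|V|] is large, once for the overlap of
   [A] and [B]. *)
exists (fun y => Pr P (A k y) / G y + Pr P (B k y) / G y
  - (Pr P (A' k y) / G y + Pr P (A' k y) / G y + Pr P (B' k y) / G y)).
exists (fun y => Pr P (A (- k) y) / G y + Pr P (B (- k) y) / G y
  + (Pr P (A' (- L) y) / G y + Pr P (B' (- L) y) / G y + Pr P (J y) / G y)).
split; last 2 first.
- rewrite mulrDl -[X in _ --> X]subr0; apply: cvgB; first exact: cvgD.
  by rewrite -[X in _ --> X]addr0; apply: cvgD => //;
    rewrite -[X in _ --> X]addr0; exact: cvgD.
- rewrite -[X in expR X]opprK mulrDl -[X in _ --> X]addr0.
  apply: cvgD; first exact: cvgD.
  by rewrite -[X in _ --> X]addr0; apply: cvgD => //;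
    rewrite -[X in _ --> X]addr0; exact: cvgD.
have mnU : measurable_fun setT (fun w => `|U w|) by exact: measurableT_comp.
have mnV : measurable_fun setT (fun w => `|V w|) by exact: measurableT_comp.
have maU : measurable_fun setT (fun w => a * U w) by exact: measurable_funM.
have mbV : measurable_fun setT (fun w => b * V w) by exact: measurable_funM.
have mA h y : measurable (A h y) by exact: measurable_gt.
have mB h y : measurable (B h y) by exact: measurable_gt.
have mA' h y : measurable (A' h y) by apply: measurableI; exact: measurable_gt.
have mB' h y : measurable (B' h y) by apply: measurableI; exact: measurable_gt.
have mJ y : measurable (J y) by apply: measurableI; exact: measurable_gt.
have mSy y : measurable [set w | y < a * U w + b * V w].
  by apply: measurable_gt; exact: measurable_funD.
near=> y.
have y0 : 0 < y by near: y; exact: nbhs_pinfty_gt.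
have fy0 : 0 < f y by near: y.
have kf0 : 0 < k * f y by exact: mulr_gt0.
rewrite -!mulrDl -mulrBl !ler_pM2r ?invr_gt0//; apply/andP; split.
- rewrite lerBlDr PrUI//.
  have : Pr P (A k y `|` B k y) <=
      Pr P [set w | y < a * U w + b * V w] + (Pr P (A' k y) + Pr P (B' k y)).
    apply: le_trans (lerD (lexx _) (PrU_le _ _)) => //.
    apply: le_trans (PrU_le _ _) => //; last exact: measurableU.
    apply: le_Pr => [||w]; [exact: measurableU|by do 2?apply: measurableU|].
    have aU := scaled_norm_ge ab01 (U w); have bV := scaled_norm_ge bb01 (V w).
    rewrite /A /B /A' /B' /= => -[Aw|Bw].
    + have [Vk|kV] := leP `|V w| (k * f y); [left; lra|right; left; split=> //].
      by apply: (lt_le_trans Aw); apply: scaled_le => //; lra.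
    + have [Uk|kU] := leP `|U w| (k * f y); [left; lra|right; right; split=> //].
      by apply: (lt_le_trans Bw); apply: scaled_le => //; lra.
  (* On the overlap, V >= bV > y + k f(y) > k f(y), so [V] is large together with [U]. *)
  suff : Pr P (A k y `&` B k y) <= Pr P (A' k y) by lra.
  apply: le_Pr => // [|w [Aw Bw]]; first exact: measurableI.
  rewrite /A /B /= in Aw Bw.
  have aU : a * U w <= U w by apply: scaled_le => //; lra.
  have bV : b * V w <= V w by apply: scaled_le => //; lra.
  by have V_le := ler_norm (V w); split => /=; lra.
- apply: (@le_trans _ _ (Pr P (A (- k) y `|` B (- k) y `|`
      (A' (- L) y `|` B' (- L) y `|` J y)))).
    apply: le_Pr => [||w]; [done|by do 3?apply: measurableU|].
    rewrite /A /B /A' /B' /J /= => Sw.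
    have [Aw|Aw] := ltP (y + - k * f y) (a * U w); first by left; left.
    have [Bw|Bw] := ltP (y + - k * f y) (b * V w); first by left; right.
    have aU : a * U w <= U w by apply: scaled_le => //; lra.
    have bV : b * V w <= V w by apply: scaled_le => //; lra.
    (* Neither term passes y - k f(y), so each exceeds k f(y). If moreover U and V are at most y - L
       f(y), so are aU and bV, and each must exceed L f(y). *)
    have [U_le V_le] := (ler_norm (U w), ler_norm (V w)); right.
    have [Uw|Uw] := ltP (y + - L * f y) (U w).
      by left; left; split => //; lra.
    have [Vw|Vw] := ltP (y + - L * f y) (V w).
      by left; right; split => //; lra.
    by right; split; lra.
  apply: le_trans (PrU_le _ _) _; [by do 3?apply: measurableU..|].
  apply: lerD; first exact: PrU_le.
  apply: le_trans (PrU_le _ _) _ => //; first exact: measurableU.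
  by rewrite lerD2r; exact: PrU_le.
Unshelve. all: by end_near. Qed.

(** * From the distribution function of [U] to a Gumbel tail *)

Lemma Pr_ccdf (U : {RV P >-> R}) (x : R) :
  Pr P [set w | x < U w] = fine (ccdf U x).
Proof. by rewrite /ccdf /distribution /pushforward preimage_itvoy. Qed.

Lemma survivalE (U : {RV P >-> R}) :
  survival (distribution_function U) = fun x => Pr P [set w | x < U w].
Proof.
by apply/funext => x; rewrite Pr_ccdf ccdf_1_cdf fineB ?fin_num_measure.
Qed.

Lemma gumbel_tail_Pr (U : {RV P >-> R}) (f : R -> R) :
  right_endpoint (distribution_function U) = +oo%E ->
  auxiliary_function (distribution_function U) f ->
  gumbel_tail (fun x => Pr P [set w | x < U w]) f.
Proof.
move=> Uoo [f0 _ _ _]; rewrite survivalE => Uf.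
have Gni (x y : R) : x <= y -> Pr P [set w | y < U w] <= Pr P [set w | x < U w].
  move=> xy; apply: le_Pr; [exact: measurable_gt..|].
  by move=> w /=; exact: le_lt_trans.
split => // [x||].
(* A zero of the tail at [x] would persist beyond [x] by monotonicity and bound the right endpoint
   by [x]. *)
- rewrite lt_neqAle Pr_ge0 andbT; apply/eqP => Gx0.
  suff : (right_endpoint (distribution_function U) <= x%:E)%E by rewrite Uoo.
  apply: ge_ereal_sup => _ [z /= Fz <-]; rewrite lee_fin leNgt; apply/negP => xz.
  have /(congr1 (@^~ z)) := survivalE U; rewrite /survival.
  have := Gni _ _ (ltW xz); lra.
- by move=> x y; exact: Gni.
- by under eq_fun do rewrite Pr_ccdf; exact: fine_cvg (cvg_ccdfy0 U).
Qed.

End tail_probabilities.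

(** * Reduction to coefficients in [0, 1] by rescaling *)

Theorem theorem4p1 (d : measure_display) (T : measurableType d) (R : realType)
  (P : probability T R) (U V : {RV P >-> R}) (f : R -> R) (c : R)
  (Uendpoint : right_endpoint (distribution_function U) = +oo%E)
  (UMDA : MDA_Gumbel (distribution_function U))
  (Uaux : auxiliary_function (distribution_function U) f)
  (c_gt0 : 0 < c)
  (tailVU : Pr P [set w | x < V w] / Pr P [set w | x < U w] @[x --> +oo] --> c)
  (condVU : forall t : R, 0 < t ->
     condPr P [set w | t * f x < `|V w|] [set w | x < U w]
       @[x --> +oo] --> (0 : R))
  (condUV : forall t : R, 0 < t ->
     condPr P [set w | t * f x < `|U w|] [set w | x < V w]
       @[x --> +oo] --> (0 : R))
  (jointUV : exists2 L : R, 0 < L &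
     Pr P [set w | L * f x < V w /\ L * f x < U w] / Pr P [set w | x < U w]
       @[x --> +oo] --> (0 : R))
  (a1 a2 : R) (a1_ge0 : 0 <= a1) (a2_ge0 : 0 <= a2)
  (a_neq0 : ~ (a1 = 0 /\ a2 = 0)) :
  let S2 := fun w : T => a1 * U w + a2 * V w in
  let m2 := Num.max a1 a2 in
  asymp_equiv
    (fun x => Pr P [set w | x < S2 w])
    (fun x => Pr P [set w | x / m2 < U w]
              * ((a1 == m2)%:R + c * (a2 == m2)%:R)).
Proof.
move=> S2 m2.
have GT := gumbel_tail_Pr Uendpoint Uaux.
have [L _ joint] := jointUV; have [_ _ _ fSN _] := Uaux.
have [G0 _ _ _ _] := GT.
have m0 : 0 < m2.
  rewrite lt_neqAle /m2 le_max a1_ge0 andbT; apply/eqP => m20; apply: a_neq0.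
  have : a1 <= Num.max a1 a2 /\ a2 <= Num.max a1 a2 by rewrite !le_max !lexx orbT.
  by rewrite -m20; split; lra.
have am (a : R) : 0 <= a -> a <= m2 -> 0 <= a / m2 <= 1.
  by move=> ? ?; rewrite divr_ge0 ?(ltW m0)//= ler_pdivrMr// mul1r.
have am1 (a : R) : (a / m2 == 1) = (a == m2).
  by rewrite -(divff (lt0r_neq0 m0)) (inj_eq (divIf (lt0r_neq0 m0))).
have UU : Pr P [set w | x < U w] / Pr P [set w | x < U w] @[x --> +oo] --> (1 : R).
  by under eq_fun do rewrite divff ?gt_eqF//; exact: cvg_cst.
have a1m : a1 <= m2 by rewrite le_max lexx.
have a2m : a2 <= m2 by rewrite le_max lexx orbT.
have := Pr_lincomb_tail GT fSN UU tailVU condVU condUV joint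
  (am _ a1_ge0 a1m) (am _ a2_ge0 a2m).
rewrite !am1 mulr1 [_ * c]mulrC; set C := (_ + _) => lim.
(* The maximum is attained, so at least one of the contributions 1 and [c] is present; dividing by
   [C] then turns the limit [C] into 1. *)
have C0 : 0 < C.
  rewrite /C /m2; have [_|_] := leP a1 a2; rewrite eqxx.
    by rewrite mulr1 ltr_wpDl.
  by rewrite ltr_pwDl// mulr_ge0// ltW.
have xm : x / m2 @[x --> +oo] --> +oo.
  by apply: gt0_cvgMly; [rewrite invr_gt0|exact: cvg_id].
have S2E x : [set w | x / m2 < a1 / m2 * U w + a2 / m2 * V w] =
    [set w | x < S2 w].
  apply/funext => w /=.
  by rewrite !(mulrAC _ m2^-1) -mulrDl ltr_pM2r ?invr_gt0.
have limS : Pr P [set w | x < S2 w] / Pr P [set w | x / m2 < U w]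
    @[x --> +oo] --> C.
  by under eq_fun do rewrite -S2E; exact: cvg_comp xm lim.
rewrite /asymp_equiv -(divff (lt0r_neq0 C0)).
by under eq_fun do rewrite invfM mulrA; exact: cvgMr_tmp.
Qed.
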